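(* Let $c\ge 3$. Consider the collection of all 2-bridge knots of crossing number $c$, counted exactly once or twice, obtained by considering every choice of $\varepsilon_i\in\{1,2\}$ for $2\le i\le c-1$ and $\varepsilon_1=1=\varepsilon_c$ in the words $$(+)^{\varepsilon_1}(-)^{\varepsilon_2}(+)^{\varepsilon_3}(-)^{\varepsilon_4}\cdots(-)^{\varepsilon_{c-1}}(+)^{\varepsilon_c}\ \text{ for } c \text{ odd},\qquad (+)^{\varepsilon_1}(-)^{\varepsilon_2}(+)^{\varepsilon_3}(-)^{\varepsilon_4}\cdots(+)^{\varepsilon_{c-1}}(-)^{\varepsilon_c}\ \text{ for } c \text{ even},$$ with length $\ell=\sum_{i=1}^c\varepsilon_i\equiv 1 \bmod 3$. Then there are exactly $\frac{2^{c-2}+*}{3}$ (or approximately $\frac{2^{c-2}}{3}$) elements in this collection, where $$*=\begin{cases}2\cos\frac{(c-2)\pi}{3} & \text{if } c\equiv 1 \bmod 3,\\[2pt] 2\cos\frac{(c-4)\pi}{3} & \text{if } c\equiv 0 \bmod 3,\\[2pt] 2\cos\frac{(c-6)\pi}{3} & \text{if } c\equiv 2 \bmod 3.\end{cases}$$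
   Context: The collection is indexed by the words: its elements are in bijection with the tuples $(\varepsilon_1,\dots,\varepsilon_c)$ satisfying the stated conditions, each such word determining a 2-bridge knot of crossing number $c$ (a knot and its mirror image are not distinguished). Counted this way, every 2-bridge knot of crossing number $c$ appears exactly twice, except those coming from words of palindromic type, which appear exactly once. A word has palindromic type if $c$ is odd and the word equals its reverse, or $c$ is even and the word equals the reverse of its mirror image (the mirror image exchanges $+$ and $-$). Here $(+)^{\varepsilon}$, $(-)^{\varepsilon}$ denote a run of $\varepsilon$ equal letters. The knot of a word of length $\ell$ is the closure of the following long knot diagram: a 3-strand braid drawn left to right with strands at heights $1,2,3$ (bottom to top), whose $j$-th crossing ($1\le j\le\ell$) lies between heights $1,2$ for $j$ odd and $2,3$ for $j$ even, with overstrand of slope $+1$ or $-1$ according to whether the $j$-th letter is $+$ or $-$. On the left, strand 1 is the left end and strands 2, 3 are joined. On the right, if $\ell$ is odd, strands 2, 3 are joined and strand 1 is the right end; if $\ell$ is even, strands 1, 2 are joined and strand 3 is the right end. *)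

(* Defs.v *)
From HB Require Import structures.
From mathcomp Require Import all_boot all_order all_algebra.
From mathcomp Require Import all_classical all_reals all_analysis.

Set Implicit Arguments.
Unset Strict Implicit.
Unset Printing Implicit Defensive.
Import Order.TTheory GRing.Theory Num.Theory.
Import numFieldNormedType.Exports.

Local Open Scope classical_set_scope.
Local Open Scope ring_scope.

Section KnotTypes.
Variable R : realType.
Implicit Types K : set 'rV[R]_3.

(* Orientation-reversing homeomorphisms are allowed, so that a knot and its
   mirror image are equivalent. *)
Definition knot_equiv K K' : Prop :=
  exists f g : 'rV[R]_3 -> 'rV[R]_3,
    [/\ continuous f, continuous g, cancel f g, cancel g f & f @` K = K'].

(* The equivalence class of K, so that two knots are the same exactly when
   their knot types are equal sets. *)
Definition knot_type K : set (set 'rV[R]_3) := [set K' | knot_equiv K K'].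

End KnotTypes.

Section WordKnot.
Variable R : realType.

Definition point3 (x y z : R) : 'rV[R]_3 :=
  \row_(i < 3) nth 0 [:: x; y; z] i.

Definition straight_segment (p q : 'rV[R]_3) : set 'rV[R]_3 :=
  [set (1 - t) *: p + t *: q | t in [set t : R | 0 <= t <= 1]].

Fixpoint polyline (s : seq 'rV[R]_3) : set 'rV[R]_3 :=
  match s with
  | p :: ((q :: _) as s') => straight_segment p q `|` polyline s'
  | _ => set0
  end.

(* The diagram lies in the plane z = 0, with x running from left to right and
   y the height of a strand; an overstrand is pushed up to z = 1 at its
   crossing.  Letters are booleans, with true for + and false for -.
   Crossings are numbered from 0, the j-th one occupying j <= x <= j + 1, so
   that heights 1, 2 cross for j even and heights 2, 3 for j odd. *)
Definition crossing (j : nat) (plus : bool) : set 'rV[R]_3 :=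
  let x : R := j%:R in
  let a : R := if odd j then 2 else 1 in
  let b : R := if odd j then 1 else 3 in
  polyline [:: point3 x a 0;
               point3 (x + 2^-1) (a + 2^-1) (if plus then 1 else 0);
               point3 (x + 1) (a + 1) 0]
  `|` polyline [:: point3 x (a + 1) 0;
                   point3 (x + 2^-1) (a + 2^-1) (if plus then 0 else 1);
                   point3 (x + 1) a 0]
  `|` polyline [:: point3 x b 0; point3 (x + 1) b 0].

Definition braid3 (w : seq bool) : set 'rV[R]_3 :=
  \bigcup_(j in [set j : nat | (j < size w)%N]) crossing j (nth true w j).

Definition left_cap : set 'rV[R]_3 :=
  polyline [:: point3 0 2 0; point3 (-1) (5 / 2) 0; point3 0 3 0].

Definition right_cap (l : nat) : set 'rV[R]_3 :=
  let a : R := if odd l then 2 else 1 in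
  polyline [:: point3 l%:R a 0; point3 (l%:R + 1) (a + 2^-1) 0;
               point3 l%:R (a + 1) 0].

(* Joins the two ends of the long knot, running below the braid. *)
Definition closing_arc (l : nat) : set 'rV[R]_3 :=
  let b : R := if odd l then 1 else 3 in
  polyline [:: point3 0 1 0; point3 (-2) 1 0; point3 (-2) 0 0;
               point3 (l%:R + 2) 0 0; point3 (l%:R + 2) b 0;
               point3 l%:R b 0].

Definition word_closure (w : seq bool) : set 'rV[R]_3 :=
  braid3 w `|` left_cap `|` right_cap (size w) `|` closing_arc (size w).

End WordKnot.

(* The run lengths eps_1, ..., eps_c are e 0, ..., e (c - 1). *)
Definition run_lengths (c : nat) (e : {ffun 'I_c -> 'I_3}) : bool :=
  [forall i : 'I_c, ((e i : nat) == 1%N) || ((e i : nat) == 2%N)]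
  && [forall i : 'I_c,
        (((i : nat) == 0%N) || ((i : nat) == c.-1)) ==> ((e i : nat) == 1%N)].

Definition run_word (c : nat) (e : {ffun 'I_c -> 'I_3}) : seq bool :=
  flatten [seq nseq (e i) (~~ odd i) | i <- enum 'I_c].

(* A list, since a knot type may occur for several words and is then counted
   once for each of them. *)
Definition two_bridge_collection (R : realType) (c : nat) :
    seq (set (set 'rV[R]_3)) :=
  [seq knot_type (word_closure (R := R) (run_word e)) |
     e <- enum {: {ffun 'I_c -> 'I_3}} &
     run_lengths e && (\sum_(i < c) (e i : nat) == 1 %[mod 3])%N].

Definition star (R : realType) (c : nat) : R :=
  if (c %% 3 == 1)%N then 2 * cos ((c%:R - 2) * pi / 3)
  else if (c %% 3 == 0)%N then 2 * cos ((c%:R - 4) * pi / 3)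
  else 2 * cos ((c%:R - 6) * pi / 3).

(* Main.v *)
Require Import Defs.
From HB Require Import structures.
From mathcomp Require Import all_boot all_order all_algebra.
From mathcomp Require Import algC cyclotomic.
From mathcomp Require Import all_classical all_reals all_analysis.
From mathcomp Require Import ring lra.
Import Order.TTheory GRing.Theory Num.Theory.
Import numFieldNormedType.Exports.
Local Open Scope classical_set_scope.
Local Open Scope ring_scope.

(** The collection has one entry per word, so its size is the number of tuples
    of [n = c - 2] free run lengths in {1, 2}, framed by two runs of length 1,
    whose total length is 1 mod 3.

    Give a word of length [l] the weight [x ^+ l].  The free runs being chosen
    independently, the weights of all words sum to [x ^+ 2 * (x + x ^+ 2) ^+ n]
    ([sum_run_lengths]).  For [x = 1] this is [2 ^+ n].  For a primitive cube
    root of unity [z] it is [(-1) ^+ n * z ^+ 2], because [z + z ^+ 2 = -1].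
    Combining the values at 1, [z] and [z ^+ 2] so as to select the residue 1
    ([cube_root_filter]) gives [3 N = 2 ^+ n - (-1) ^+ n] for the number [N] of
    words ([card_run_lengths_mod3]).

    On the trigonometric side, each of the three angles defining [star] is a
    multiple of pi minus pi / 3, and [cos (pi / 3) = 1 / 2], so all three cases
    amount to [star R c = (-1) ^+ c.+1] ([starE]), the opposite of [(-1) ^+ n].
    Divided by the main term [2 ^+ n / 3], the count is 1 plus a multiple of
    [(-1 / 2) ^+ c], whence the limit. *)

(** * Counting words by total length modulo 3 *)

Definition allowed_run (c : nat) (i : 'I_c) : pred 'I_3 :=
  fun j => if ((i : nat) == 0%N) || ((i : nat) == c.-1) then (j : nat) == 1%N
           else ((j : nat) == 1%N) || ((j : nat) == 2%N).

Lemma run_lengthsE c (e : {ffun 'I_c -> 'I_3}) :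
  run_lengths e = (e \in family (allowed_run c)).
Proof.
apply/andP/familyP => [[/forallP e12 /forallP e1] i|eP].
  rewrite /allowed_run unfold_in; case: ifP => [iends|_]; last exact: e12.
  by have := e1 i; rewrite iends.
split; apply/forallP => i; have := eP i; rewrite /allowed_run unfold_in.
  by case: ifP => // _ ->.
by case: ifP.
Qed.

(** The generating function of the words by total length.  The constraint on a
    tuple of run lengths is a separate constraint on each run, so the sum over
    tuples is the expansion of a product of one factor per run: [x] for the two
    outer runs and [x + x ^+ 2] for the inner ones. *)
Lemma sum_run_lengths (A : comPzRingType) (x : A) n :
  \sum_(e : {ffun 'I_n.+2 -> 'I_3} | run_lengths e) x ^+ (\sum_i (e i : nat))%N
    = x ^+ 2 * (x + x ^+ 2) ^+ n.
Proof.
under eq_bigl do rewrite run_lengthsE.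
under eq_bigr do rewrite -prodrXr.
rewrite -[LHS](bigA_distr_big_dep (allowed_run n.+2)
  (fun _ j => x ^+ (j : nat))) /=.
have sum_runs (i : 'I_n.+2) : \sum_(j | allowed_run n.+2 i j) x ^+ (j : nat)
    = if ((i : nat) == 0%N) || ((i : nat) == n.+1) then x else x + x ^+ 2.
  rewrite big_mkcond !big_ord_recl big_ord0 /allowed_run /=.
  by case: (_ || _); rewrite /= ?expr1 ?add0r ?addr0.
under eq_bigr do rewrite sum_runs.
rewrite big_ord_recl big_ord_recr /= eqxx.
under eq_bigr => i _ do rewrite /bump /= add1n eqSS ltn_eqF ?ltn_ord//=.
by rewrite prodr_const card_ord; ring.
Qed.

Lemma prim3_root_sum (F : idomainType) (z : F) :
  3.-primitive_root z -> z + z ^+ 2 = -1.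
Proof.
move=> z3; have z1 : z - 1 != 0.
  by rewrite subr_eq0 -[z]expr1 -(prim_order_dvd z3).
apply/(mulfI z1)/eqP; rewrite -subr_eq0; apply/eqP.
have -> : (z - 1) * (z + z ^+ 2) - (z - 1) * -1 = z ^+ 3 - 1 by ring.
by rewrite (prim_expr_order z3) subrr.
Qed.

(** The left-hand side is [1 + u + u ^+ 2] for the cube root of unity
    [u = z ^+ (m - 1)], as [z ^+ 2] and [z] are the inverses of [z] and
    [z ^+ 2]. *)
Lemma cube_root_filter (F : idomainType) (z : F) m : 3.-primitive_root z ->
  1 + z ^+ 2 * z ^+ m + z * (z ^+ 2) ^+ m = ((m == 1 %[mod 3])%N : nat)%:R *+ 3.
Proof.
move=> z3; have zz := prim3_root_sum F z z3; have z31 := prim_expr_order z3.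
rewrite exprAC -(prim_expr_mod z3 m).
have : (m %% 3 < 3)%N by rewrite ltn_mod.
case: (m %% 3)%N => [|[|[|//]]] _ /=.
- by rewrite expr0 expr1n !mulr1 mul0rn -addrA [z ^+ 2 + z]addrC zz subrr.
- by rewrite -exprM -exprD -exprS !z31; ring.
rewrite mul0rn -exprM mulnn -exprD -exprS.
by rewrite (exprD z 3 1) (exprD z 3 2) z31 !mul1r expr1 -addrA zz subrr.
Qed.

(** The filter turns the count into the values of the generating function at
    the three cube roots of unity, where [z] and [z ^+ 2] together contribute
    [(-1) ^+ n * (z + z ^+ 2) = - (-1) ^+ n]. *)
Lemma card_run_lengths_mod3 n :
  #|[pred e : {ffun 'I_n.+2 -> 'I_3} |
       run_lengths e && (\sum_i (e i : nat) == 1 %[mod 3])%N]|%:R *+ 3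
    = 2 ^+ n - (-1) ^+ n :> int.
Proof.
have [z z3] := C_prim_root_exists (isT : (0 < 3)%N).
have zz := prim3_root_sum _ z z3; have z31 := prim_expr_order z3.
apply: (@intr_inj algC).
rewrite rmorphMn rmorphB !rmorphXn rmorphN /= rmorph_nat rmorph1.
rewrite -sum1_card natr_sum.
rewrite (eq_bigl _ _ (fun e => erefl)) big_mkcondr /=.
transitivity (\sum_(e : {ffun 'I_n.+2 -> 'I_3} | run_lengths e)
  (1 ^+ (\sum_i (e i : nat))%N + z ^+ 2 * z ^+ (\sum_i (e i : nat))%N
     + z * (z ^+ 2) ^+ (\sum_i (e i : nat))%N)).
  rewrite -sumrMnl; apply: eq_bigr => e _.
  by rewrite expr1n cube_root_filter//; case: eqP.
rewrite !big_split /= -!mulr_sumr !sum_run_lengths.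
rewrite -exprM (exprD z 3 1) z31 mul1r expr1 [z ^+ 2 + z]addrC zz.
rewrite !expr1n.
have -> : z ^+ 2 * (z ^+ 2 * (-1) ^+ n) = z ^+ 3 * (z * (-1) ^+ n) by ring.
have -> : z * (z * (-1) ^+ n) = z ^+ 2 * (-1) ^+ n by ring.
rewrite z31 !mul1r -addrA -mulrDl zz.
by rewrite mulN1r; congr (_ ^+ n - _); ring.
Qed.

Lemma size_two_bridge_collection (R : realType) c : (2 <= c)%N ->
  (size (two_bridge_collection R c))%:R
    = (2 ^+ (c - 2)%N - (-1) ^+ c) / 3 :> R.
Proof.
case: c => [|[|n]]// _; rewrite !subSS subn0 !exprS mulN1r mulN1r opprK.
have /(congr1 (intr : int -> R)) := card_run_lengths_mod3 n.
rewrite rmorphMn rmorphB !rmorphXn rmorphN /= rmorph_nat rmorph1 => <-.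
rewrite size_map size_filter -sum1_count big_enum_cond /= sum1_card.
by rewrite -[_ *+ 3]mulr_natr mulfK ?pnatr_eq0.
Qed.

(** * The trigonometric term *)

(** The tripling formula at pi / 3 says that [x = cos (pi / 3)] is a root of
    [4 x^3 - 3 x + 1 = (x + 1) (2 x - 1)^2], and [x] is positive. *)
Lemma cos_pi_third (R : realType) : cos (pi / 3) = 2^-1 :> R.
Proof.
set t : R := pi / 3; have pi0 := pi_gt0 R.
have cos3 : cos t * 4 * cos t ^+ 2 - 3 * cos t = -1.
  rewrite -(cospi R); have -> : pi = t *+ 2 + t by rewrite /t; field.
  rewrite cosD mulr2n cosD sinD.
  have -> : (sin t * cos t + cos t * sin t) * sin t = 2 * cos t * sin t ^+ 2.
    by ring.
  by rewrite -!expr2 sin2cos2; ring.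
have cos_gt0 : 0 < cos t by apply: cos_gt0_pihalf; rewrite /t; lra.
have : (cos t + 1) * (2 * cos t - 1) ^+ 2 = 0.
  by transitivity (cos t * 4 * cos t ^+ 2 - 3 * cos t + 1);
    [ring|rewrite cos3 addNr].
move/eqP; rewrite mulf_eq0 sqrf_eq0 => /orP[]/eqP; lra.
Qed.

Lemma cos_natmul_piBpi_third (R : realType) m :
  2 * cos (m%:R * pi - pi / 3) = (-1) ^+ m :> R.
Proof.
elim: m => [|m IHm].
  by rewrite mul0r sub0r cosN cos_pi_third expr0 mulfV ?pnatr_eq0.
rewrite exprS -IHm mulN1r -[- (2 * _)]mulrN -cosDpi; congr (2 * cos _).
by rewrite -natr1; ring.
Qed.

(** With [m = c %/ 3], the angle is [m * pi - pi / 3] when [c] is 1 mod 3, and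
    pi less otherwise, which changes the sign; and [c] has the parity of
    [m + c %% 3]. *)
Lemma starE (R : realType) c : star R c = (-1) ^+ c.+1.
Proof.
set m := (c %/ 3)%N.
have cE : c%:R = m%:R * 3 + (c %% 3)%N%:R :> R.
  by rewrite {1}(divn_eq c 3) natrD natrM.
have -> : (-1) ^+ c.+1 = (-1) ^+ (m + (c %% 3).+1) :> R.
  rewrite {1}(divn_eq c 3) -addnS -signr_odd oddD oddM andbT -oddD.
  by rewrite signr_odd.
rewrite /star cE; have : (c %% 3 < 3)%N by rewrite ltn_mod.
have cosB (x : R) : cos (x - pi) = - cos x
  by rewrite -{2}(subrK pi x) cosDpi opprK.
case: (c %% 3)%N => [|[|[|//]]] _ /=.
- have -> : (m%:R * 3 + 0%:R - 4) * pi / 3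
      = m%:R * pi - pi / 3 - pi :> R by field.
  by rewrite cosB mulrN cos_natmul_piBpi_third addn1 exprS mulN1r.
- have -> : (m%:R * 3 + 1%:R - 2) * pi / 3
      = m%:R * pi - pi / 3 :> R by field.
  by rewrite cos_natmul_piBpi_third addn2 !exprS !mulN1r opprK.
- have -> : (m%:R * 3 + 2%:R - 6) * pi / 3
      = m%:R * pi - pi / 3 - pi :> R by field.
  by rewrite cosB mulrN cos_natmul_piBpi_third addn3 !exprS !mulN1r opprK.
Qed.

(** * The count *)

Theorem theorem2p6 (R : realType) :
  (forall c : nat, (3 <= c)%N ->
     (size (two_bridge_collection R c))%:R
       = (2 ^+ (c - 2)%N + star R c) / 3 :> R)
  /\ ((fun c : nat =>
         (size (two_bridge_collection R c))%:R / (2 ^+ (c - 2)%N / 3) : R)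
        @ \oo --> (1 : R)).
Proof.
split=> [c c3|].
  by rewrite size_two_bridge_collection ?(ltnW c3)// starE exprS mulN1r.
(* The coefficient -4 comes from [- (-1) ^+ c / 2 ^+ (c - 2)]. *)
have lim : (fun c => 1 + geometric (-4) (- 2^-1) c : R) @ \oo --> (1 : R).
  rewrite -[X in _ --> X]addr0; apply: cvgD; first exact: cvg_cst.
  by apply: cvg_geometric; rewrite normrN ger0_norm; lra.
apply: cvg_trans lim; apply: near_eq_cvg; near=> c.
have c2 : (2 <= c)%N by near: c; exact: nbhs_infty_ge.
rewrite size_two_bridge_collection// -{1 3}(subnK c2) /=.
set n := (c - 2)%N; have p0 : 2 ^+ n != 0 :> R by rewrite expf_neq0.
rewrite !exprD -{1}[- 2^-1]mulN1r exprMn exprVn.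
by field.
Unshelve. all: by end_near.
Qed.
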